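(* Let $d,n_0,n_1,\dots,n_d\in\mathbb{N}$, let $\Omega_1,\dots,\Omega_d\subseteq\mathbb{R}$, $\mathcal{X}=\Omega_1\times\dots\times\Omega_d$, and let $\mu_{\mathcal{X}}$ be a probability measure on $\mathcal{X}$. For $\nu=1,\dots,d$ let $\Phi_\nu=(\varphi^\nu_1,\dots,\varphi^\nu_{n_\nu})^{\mathsf T}:\Omega_\nu\to\mathbb{R}^{n_\nu}$ be a vector of linearly independent continuous functions, such that all products $x\mapsto\varphi^1_{j_1}(x_1)\cdots\varphi^d_{j_d}(x_d)$ belong to $L_2(\mathcal{X};\mu_{\mathcal{X}})$, and let $\Phi(x)=\Phi_1(x_1)\otimes\dots\otimes\Phi_d(x_d)$. Let $\tau:\mathcal{M}\to\mathcal{T}\subseteq\mathbb{R}^{n_0\times n_1\times\dots\times n_d}$ be a parametrization of a low-rank tensor manifold, let $G(\mathsf{A})=\langle\mathsf{A},\Phi(\cdot)\rangle$ for $\mathsf{A}\in\mathcal{T}$, let $\sigma$ be the softmax function, and let $$\bar F:\mathcal{M}\to\mathcal{S},\qquad \bar F(\Theta)=\sigma\circ\big(G(\tau(\Theta))\big)=\sigma\big(\langle\tau(\Theta),\Phi(\cdot)\rangle\big),$$ where $\mathcal{S}=\bar F(\mathcal{M})$ is equipped with the Fisher--Rao type metric $\langle\zeta,\xi\rangle_s=\int_{\mathcal{X}}\zeta(x)^{\mathsf T}\mathcal{F}(s(x))\,\xi(x)\,\mu_{\mathcal{X}}(dx)$. Then for every $\Theta\in\mathcal{M}$, $$D\bar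 F(\Theta)^*D\bar F(\Theta)=\int_{\mathcal{X}}D\tau(\Theta)^*\Big(C(f_x)\otimes\Phi_1(x_1)\Phi_1(x_1)^{\mathsf T}\otimes\dots\otimes\Phi_d(x_d)\Phi_d(x_d)^{\mathsf T}\Big)D\tau(\Theta)\,\mu_{\mathcal{X}}(dx),$$ where $f_x=G(\tau(\Theta))(x)=\langle\tau(\Theta),\Phi(x)\rangle\in\mathbb{R}^{n_0}$ and $$C(z)=D\sigma(z)^*\,\mathcal{F}(\sigma(z))\,D\sigma(z)\in\mathbb{R}^{n_0\times n_0}.$$
   Context: Contraction: $\langle\mathsf{A},\Phi(x)\rangle\in\mathbb{R}^{n_0}$ has $k$-th component $\sum_{j_1,\dots,j_d}\mathsf{A}_{k,j_1,\dots,j_d}\varphi^1_{j_1}(x_1)\cdots\varphi^d_{j_d}(x_d)$. Low-rank model: $\mathcal{T}\subseteq\mathbb{R}^{n_0\times\dots\times n_d}$ is an embedded submanifold of low-rank tensors (e.g. tree tensor networks of fixed ranks); $\mathcal{M}=U_1\times\dots\times U_{d'}$ is a product of embedded submanifolds $U_k\subseteq\mathbb{R}^{m_k}$, equipped with a Riemannian metric; and $\tau:\mathcal{M}\to\mathcal{T}$ is a smooth surjective map that is the restriction to $\mathcal{M}$ of a multilinear map $\mathbb{R}^{m_1}\times\dots\times\mathbb{R}^{m_{d'}}\to\mathbb{R}^{n_0\times\dots\times n_d}$. Softmax and Fisher--Rao metric: $S_{n_0}=\{p\in\mathbb{R}^{n_0}:\sum_jp_j=1,\ p_j>0\}$ is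 the open probability simplex, with tangent spaces $T_pS_{n_0}=\{q\in\mathbb{R}^{n_0}:\sum_jq_j=0\}$. The softmax $\sigma:\mathbb{R}^{n_0}\to S_{n_0}$ is $\sigma(z)_j=\exp(z_j)/\sum_{k=1}^{n_0}\exp(z_k)$. The Fisher information matrix is $\mathcal{F}(p)=\operatorname{diag}(1/p_1,\dots,1/p_{n_0})$. $\mathcal{S}=\{\sigma\circ f: f\in G(\mathcal{T})\}$ consists of functions $\mathcal{X}\to S_{n_0}$; it is assumed to be a finite-dimensional manifold, smoothly parametrized by the submersion $\bar F$, whose tangent vectors are functions $\mathcal{X}\to\mathbb{R}^{n_0}$, with $D\bar F(\Theta)[\xi](x)=D\sigma(f_x)\big[\langle D\tau(\Theta)[\xi],\Phi(x)\rangle\big]$. Adjoints: $D\bar F(\Theta)^*$ is taken with respect to the metric on $T_\Theta\mathcal{M}$ and the metric $\langle\cdot,\cdot\rangle_{\bar F(\Theta)}$ on $\mathcal{S}$, so that $\langle D\bar F(\Theta)^*D\bar F(\Theta)\zeta,\xi\rangle_\Theta=\langle D\bar F(\Theta)\zeta,D\bar F(\Theta)\xi\rangle_{\bar F(\Theta)}$ for all $\zeta,\xi\in T_\Theta\mathcal{M}$. $D\tau(\Theta)$ is regarded as a map from $T_\Theta\mathcal{M}$ to $\mathbb{R}^{n_0\times\dots\times n_d}$ with the Frobenius inner product, and $D\tau(\Theta)^*$ is the corresponding adjoint. In $C(z)$, $D\sigma(z)$ is the $n_0\times n_0$ Jacobian matrix $(D\sigma(z))_{i,j}=\sigma(z)_i(\delta_{i,j}-\sigma(z)_j)$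 and $D\sigma(z)^*$ is its transpose. $\otimes$ between matrices is the tensor product of linear operators acting on $\mathbb{R}^{n_0\times n_1\times\dots\times n_d}\cong\mathbb{R}^{n_0}\otimes\dots\otimes\mathbb{R}^{n_d}$. *)

(* Defs.v *)
From HB Require Import structures.
From mathcomp Require Import all_boot all_order all_algebra.
From mathcomp Require Import all_classical all_reals all_analysis.
Set Implicit Arguments.
Unset Strict Implicit.
Unset Printing Implicit Defensive.
Import Order.TTheory GRing.Theory Num.Theory.
Import numFieldNormedType.Exports.
Local Open Scope classical_set_scope.
Local Open Scope ring_scope.

(* On the finite-dimensional spaces used below, existence and continuity of
   all iterated directional derivatives is the usual C^k condition. *)
Fixpoint Ck (R : realType) (V W : normedModType R) (k : nat) (A : set V)
    (f : V -> W) : Prop :=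
  (forall x, A x -> {for x, continuous f}) /\
  if k is k'.+1 then
    forall v, (forall x, A x -> derivable f x v) /\
              Ck k' A (fun x => 'D_v f x)
  else True.

(* Only meaningful for open A; f is irrelevant outside A. *)
Definition smooth_on (R : realType) (V W : normedModType R) (A : set V)
    (f : V -> W) : Prop :=
  forall k, Ck k A f.

(* Smoothness on a subset which need not be open: local smooth extensions. *)
Definition smooth_map (R : realType) (V W : normedModType R) (A : set V)
    (f : V -> W) : Prop :=
  forall p, A p -> exists (O : set V) (h : V -> W),
    [/\ open O, O p, smooth_on O h & forall x, A x -> O x -> f x = h x].

(* C^infinity embedded submanifold, by slice charts: around each point a
   diffeomorphism flat of open sets, with inverse psi, takes A to a
   linear subspace E of dimension r. *)
Definition embedded_submanifold (R : realType) (a b : nat)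
    (A : set 'M[R]_(a, b)) : Prop :=
  exists r : nat, forall p, A p ->
  exists (O O' : set 'M[R]_(a, b)) (flat psi : 'M[R]_(a, b) -> 'M[R]_(a, b))
         (E : {vspace 'M[R]_(a, b)}),
    [/\ [/\ open O, O p & open O'],
        [/\ smooth_on O flat & smooth_on O' psi],
        (forall x, O x -> O' (flat x) /\ psi (flat x) = x),
        (forall y, O' y -> O (psi y) /\ flat (psi y) = y)
      & \dim E = r /\ forall x, O x -> (A x <-> flat x \in E)].

(* Velocities at p of smooth curves in A through p. *)
Definition tangent (R : realType) (V : normedModType R) (A : set V) (p : V) :
    set V :=
  [set v | exists (e : R) (c : R^o -> V),
     [/\ 0 < e, smooth_on `]- e, e[ c, (forall t, - e < t < e -> A (c t)),
         c 0 = p & derive1 c 0 = v]].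

Definition smooth_vector_field (R : realType) (V : normedModType R)
    (A : set V) (X : V -> V) : Prop :=
  smooth_map A X /\ forall p, A p -> tangent A p (X p).

Definition riemannian_metric (R : realType) (V : normedModType R)
    (A : set V) (g : V -> V -> V -> R) : Prop :=
  [/\ forall p, A p -> forall u v, tangent A p u -> tangent A p v ->
        g p u v = g p v u,
      forall p, A p -> forall (a : R) u v w,
        tangent A p u -> tangent A p v -> tangent A p w ->
        g p (a *: u + v) w = a * g p u w + g p v w,
      forall p, A p -> forall u, tangent A p u -> u != 0 -> 0 < g p u u
    & forall X Y, smooth_vector_field A X -> smooth_vector_field A Y ->
        smooth_map A (fun p => g p (X p) (Y p))].

(* Adjoint of L : T -> W with respect to the inner product g on the subspace
   T of V and the form h on W: the Riesz representative in T of
   xi |-> h w (L xi), unique when g is positive definite on T. *)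
Definition adjoint (R : realType) (V : lmodType R) (W : Type) (T : set V)
    (g : V -> V -> R) (h : W -> W -> R) (L : V -> W) (w : W) : V :=
  xget 0 [set v | T v /\ forall xi, T xi -> g v xi = h w (L xi)].

Notation multi_index n := {dffun forall nu, 'I_(n nu)}.

(* R^{n_0 x n_1 x ... x n_d}, unfolded along the first mode: columns enumerate
   the multi-indices (j_1, ..., j_d). *)
Notation tensor R n0 n := 'M[R]_(n0, #|{: multi_index n}|).

Definition tensor_entry (R : realType) (n0 d : nat) (n : 'I_d -> nat)
    (A : tensor R n0 n) (k : 'I_n0) (j : multi_index n) : R :=
  A k (enum_rank j).

Definition frobenius (R : realType) (n0 d : nat) (n : 'I_d -> nat)
    (A B : tensor R n0 n) : R :=
  \sum_k \sum_(j : multi_index n) tensor_entry A k j * tensor_entry B k j.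

(* (C (x) B_1 (x) ... (x) B_d) applied to A. *)
Definition tensor_op (R : realType) (n0 d : nat) (n : 'I_d -> nat)
    (C : 'M[R]_n0) (B : forall nu, 'M[R]_(n nu)) (A : tensor R n0 n) :
    tensor R n0 n :=
  \matrix_(k, c) \sum_l \sum_(j : multi_index n)
    C k l * (\prod_nu B nu ((enum_val c : multi_index n) nu) (j nu))
    * tensor_entry A l j.

(* Omega_1 x ... x Omega_d, a pointed type since the factors are nonempty. *)
Definition domain (R : realType) (d : nat) (Omega : 'I_d -> set R)
    (Omega0 : forall nu, Omega nu !=set0) : Type :=
  set_type [set x : d.-tuple (measurableTypeR R) |
             forall nu, Omega nu (tnth x nu)].

Section domain.
Context (R : realType) (d : nat) (Omega : 'I_d -> set R)
  (Omega0 : forall nu, Omega nu !=set0).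

Lemma domain_inhabited : exists x : domain Omega0, True.
Proof.
pose x0 : d.-tuple (measurableTypeR R) := [tuple sval (cid (Omega0 nu)) | nu < d].
have x0P : x0 \in [set x : d.-tuple (measurableTypeR R) |
                    forall nu, Omega nu (tnth x nu)].
  by rewrite inE /= => nu; rewrite tnth_mktuple; case: cid.
by exists (exist _ x0 x0P).
Qed.

HB.instance Definition _ := gen_eqMixin (domain Omega0).
HB.instance Definition _ := gen_choiceMixin (domain Omega0).
HB.instance Definition _ :=
  isPointed.Build (domain Omega0) (projT1 (cid domain_inhabited)).
End domain.

Definition domain_val (R : realType) (d : nat) (Omega : 'I_d -> set R)
    (Omega0 : forall nu, Omega nu !=set0) (x : domain Omega0) :
    d.-tuple (measurableTypeR R) := sval x.

(* The same type with its Borel sigma-algebra, i.e. the trace of that of R^d. *)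
Notation borel_domain Omega0 :=
  (g_sigma_algebra_preimageType (@domain_val _ _ _ Omega0)).

Definition coordinate (R : realType) (d : nat) (Omega : 'I_d -> set R)
    (Omega0 : forall nu, Omega nu !=set0) (x : borel_domain Omega0) (nu : 'I_d) : R :=
  tnth (@domain_val _ _ _ Omega0 x) nu.

(* The function x |-> phi^1_{j_1}(x_1) ... phi^d_{j_d}(x_d). *)
Definition product_feature (R : realType) (d : nat) (n : 'I_d -> nat)
    (Omega : 'I_d -> set R) (Omega0 : forall nu, Omega nu !=set0)
    (phi : forall nu, R -> 'cV[R]_(n nu)) (j : multi_index n)
    (x : borel_domain Omega0) : R :=
  \prod_nu phi nu (coordinate x nu) (j nu) 0.

Definition contraction (R : realType) (d n0 : nat) (n : 'I_d -> nat)
    (Omega : 'I_d -> set R) (Omega0 : forall nu, Omega nu !=set0)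
    (phi : forall nu, R -> 'cV[R]_(n nu)) (A : tensor R n0 n)
    (x : borel_domain Omega0) : 'cV[R]_n0 :=
  \col_k \sum_(j : multi_index n) tensor_entry A k j * product_feature phi j x.

Definition linearly_independent_on (R : realType) (n : nat) (Omega : set R)
    (f : R -> 'cV[R]_n) : Prop :=
  forall c : 'I_n -> R,
    (forall t, Omega t -> \sum_j c j * f t j 0 = 0) -> forall j, c j = 0.

Definition softmax (R : realType) (n0 : nat) (z : 'cV[R]_n0) : 'cV[R]_n0 :=
  \col_j (expR (z j 0) / \sum_k expR (z k 0)).

Definition softmax_jacobian (R : realType) (n0 : nat) (z : 'cV[R]_n0) :
    'M[R]_n0 :=
  \matrix_(i, j) (softmax z i 0 * ((i == j)%:R - softmax z j 0)).

Definition fisher (R : realType) (n0 : nat) (p : 'cV[R]_n0) : 'M[R]_n0 :=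
  diag_mx (\row_j (p j 0)^-1).

Definition fisher_pullback (R : realType) (n0 : nat) (z : 'cV[R]_n0) :
    'M[R]_n0 :=
  (softmax_jacobian z)^T *m fisher (softmax z) *m softmax_jacobian z.

Definition fisher_rao (R : realType) (n0 : nat) (dd : measure_display)
    (X : measurableType dd) (mu : {measure set X -> \bar R})
    (s zeta xi : X -> 'cV[R]_n0) : R :=
  \int[mu]_x (((zeta x)^T *m fisher (s x) *m xi x) 0 0).

(* The product U_1 x ... x U_d', inside R^(m_1) x ... x R^(m_d') identified
   with R^(m_1 + ... + m_d') by concatenation of blocks. *)
Definition product_set (R : realType) (d' : nat) (m : 'I_d' -> nat)
    (U : forall k, set 'rV[R]_(m k)) : set 'rV[R]_(\sum_(k < d') m k) :=
  [set Theta | forall k, U k (submxrow Theta k)].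

Definition set_block (R : realType) (d' : nat) (m : 'I_d' -> nat)
    (Theta : 'rV[R]_(\sum_(k < d') m k)) (k : 'I_d') (u : 'rV[R]_(m k)) :
    'rV[R]_(\sum_(k < d') m k) :=
  \mxrow_(l < d') dfwith (fun l => submxrow Theta l) k u l.

Definition multilinear (R : realType) (d' : nat) (m : 'I_d' -> nat)
    (W : lmodType R) (tau : 'rV[R]_(\sum_(k < d') m k) -> W) : Prop :=
  forall Theta k (a : R) (u v : 'rV[R]_(m k)),
    tau (set_block Theta (a *: u + v)) =
    a *: tau (set_block Theta u) + tau (set_block Theta v).

(* Domains D i and charts chi i of a smooth r-dimensional manifold structure
   on S: a countable atlas (empty domains are allowed), hence second
   countability, and Hausdorff. *)
Definition smooth_atlas (R : realType) (T : Type) (S : set T) (r : nat)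
    (D : nat -> set T) (chi : nat -> T -> 'rV[R]_r) : Prop :=
  [/\ S = \bigcup_i D i,
      forall i s t, D i s -> D i t -> chi i s = chi i t -> s = t,
      forall i j, open (chi i @` (D i `&` D j)),
      forall i j, exists h : 'rV[R]_r -> 'rV[R]_r,
        smooth_on (chi i @` (D i `&` D j)) h /\
        forall s, D i s -> D j s -> h (chi i s) = chi j s
    & forall s t, S s -> S t -> s <> t ->
        exists (i j : nat) (A B : set 'rV[R]_r),
        [/\ open A /\ open B, D i s /\ A (chi i s), D j t /\ B (chi j t)
          & forall q, D i q -> A (chi i q) -> D j q -> ~ B (chi j q)]].

(* Elements of the manifold are functions X -> W and so are its tangent
   vectors: evaluation at every x is smooth (ev i x is its expression in the
   chart chi i), and a tangent vector, with chart coordinates w, is determined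
   by the derivatives of all the evaluations along it. *)
Definition tangent_functions (R : realType) (X : Type) (W : normedModType R)
    (r : nat) (D : nat -> set (X -> W)) (chi : nat -> (X -> W) -> 'rV[R]_r) :
    Prop :=
  exists ev : nat -> X -> 'rV[R]_r -> W,
    (forall i x, smooth_on (chi i @` D i) (ev i x) /\
       forall s, D i s -> ev i x (chi i s) = s x) /\
    (forall i s w, D i s ->
       (forall x, 'd (ev i x) (chi i s) w = 0) -> w = 0).

Definition smooth_submersion (R : realType) (V : normedModType R) (T : Type)
    (r : nat) (M : set V) (F : V -> T) (D : nat -> set T)
    (chi : nat -> T -> 'rV[R]_r) : Prop :=
  forall Theta i, M Theta -> D i (F Theta) ->
  exists (O : set V) (h : V -> 'rV[R]_r),
    [/\ open O, O Theta, smooth_on O h,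
        forall Psi, M Psi -> O Psi -> D i (F Psi) /\ chi i (F Psi) = h Psi
      & forall w, exists2 xi, tangent M Theta xi & 'd h Theta xi = w].

(* F(M) is a finite-dimensional manifold of functions X -> W, and F : M -> F(M)
   is a submersion. *)
Definition submersively_parametrized (R : realType) (V : normedModType R)
    (X : Type) (W : normedModType R) (M : set V) (F : V -> X -> W) : Prop :=
  exists (r : nat) (D : nat -> set (X -> W)) (chi : nat -> (X -> W) -> 'rV[R]_r),
    [/\ smooth_atlas (F @` M) D chi, tangent_functions D chi
      & smooth_submersion M F D chi].

(* The tangent vector D F(Theta)[xi] of a manifold of functions, regarded as a
   function of x; see tangent_functions. *)
Definition diff_fun (R : realType) (V : normedModType R) (X : Type)
    (W : normedModType R) (F : V -> X -> W) (Theta xi : V) : X -> W :=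
  fun x => 'd (fun Psi => F Psi x) Theta xi.

Section softmax_model.
Context (R : realType) (d n0 : nat) (n : 'I_d -> nat) (Omega : 'I_d -> set R)
  (Omega0 : forall nu, Omega nu !=set0)
  (phi : forall nu, R -> 'cV[R]_(n nu)) (d' : nat) (m : 'I_d' -> nat)
  (tau : 'rV[R]_(\sum_(k < d') m k) -> tensor R n0 n).

Definition softmax_model (Theta : 'rV[R]_(\sum_(k < d') m k)) :
    borel_domain Omega0 -> 'cV[R]_n0 :=
  fun x => softmax (contraction phi (tau Theta) x).

Context (mu : probability (borel_domain Omega0) R)
  (U : forall k, set 'rV[R]_(m k))
  (g : 'rV[R]_(\sum_(k < d') m k) -> 'rV[R]_(\sum_(k < d') m k) ->
       'rV[R]_(\sum_(k < d') m k) -> R).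

Definition softmax_model_adjoint (Theta : 'rV[R]_(\sum_(k < d') m k)) :
    (borel_domain Omega0 -> 'cV[R]_n0) -> 'rV[R]_(\sum_(k < d') m k) :=
  adjoint (tangent (product_set U) Theta) (g Theta)
    (fisher_rao mu (softmax_model Theta)) (diff_fun softmax_model Theta).

Definition tau_adjoint (Theta : 'rV[R]_(\sum_(k < d') m k)) :
    tensor R n0 n -> 'rV[R]_(\sum_(k < d') m k) :=
  adjoint (tangent (product_set U) Theta) (g Theta)
    (@frobenius R n0 d n) ('d tau Theta).

(* The operator under the integral, at x. *)
Definition gram_integrand (Theta : 'rV[R]_(\sum_(k < d') m k))
    (x : borel_domain Omega0) (zeta : 'rV[R]_(\sum_(k < d') m k)) :
    'rV[R]_(\sum_(k < d') m k) :=
  tau_adjoint Theta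
    (tensor_op (fisher_pullback (contraction phi (tau Theta) x))
       (fun nu => phi nu (coordinate x nu) *m (phi nu (coordinate x nu))^T)
       ('d tau Theta zeta)).
End softmax_model.
Arguments softmax_model {R d n0 n Omega} Omega0 phi {d' m} tau.

(* Bochner integrability and integral of a family of operators on a linear
   subspace T of R^N, tested on vectors and read off in coordinates. *)
Definition operator_integrable (R : realType) (dd : measure_display)
    (X : measurableType dd) (mu : {measure set X -> \bar R}) (N : nat)
    (T : set 'rV[R]_N) (P : X -> 'rV[R]_N -> 'rV[R]_N) : Prop :=
  forall zeta i, T zeta -> mu.-integrable setT (fun x => (P x zeta 0 i)%:E).

Definition operator_integral (R : realType) (dd : measure_display)
    (X : measurableType dd) (mu : {measure set X -> \bar R}) (N : nat)
    (P : X -> 'rV[R]_N -> 'rV[R]_N) (zeta : 'rV[R]_N) : 'rV[R]_N :=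
  \row_i \int[mu]_x (P x zeta 0 i).

(* Main.v *)
From HB Require Import structures.
From Pilot Require Import Defs.
From mathcomp Require Import all_boot all_order all_algebra.
From mathcomp Require Import all_classical all_reals all_analysis.
From mathcomp Require Import measurable_realfun ring lra.
Set Implicit Arguments.
Unset Strict Implicit.
Unset Printing Implicit Defensive.
Import Order.TTheory GRing.Theory Num.Theory.
Import numFieldNormedType.Exports.
Local Open Scope classical_set_scope.
Local Open Scope ring_scope.

(** Why the identity holds.  Write [T] for the tangent space of the product
    manifold at [Theta].  Both sides are built from adjoints, that is, from Riesz
    representatives in [T], so everything rests on [T] being a
    finite-dimensional inner product space.

    The set [T] is defined by velocities of curves, and its linearity is the
    one geometric input.  In a slice chart [flat] sending the submanifold
    into a linear subspace [E], a vector [v] is tangent at [p] if and only if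
    its image under the differential of [flat] at [p] lies in [E]
    ([tangent_submanifold]): a curve in the submanifold is sent into [E], and
    conversely the straight line in [E] is pulled back by the inverse chart.
    The tangent space of a product is the product of the tangent spaces
    ([tangent_product]).  Slice charts are smooth in the sense of iterated
    directional derivatives, so the chain rule has to be preceded by the theorem
    that C^1 maps are Frechet differentiable ([differentiable_smooth_on]).

    A positive definite form on a linear subspace [T] of R^N has a finite
    orthonormal family [b] which spans [T] ([orthonormal_basis]), and then the
    adjoint is explicit: its value is the sum of [h w (L (b q)) *: b q]
    ([adjoint_orthonormal]).  In this form integration over [x] commutes with
    taking adjoints, because it only acts on the coefficients.

    It remains to compare coefficients.  The map [tau] is multilinear, hence
    polynomial and differentiable ([differentiable_multilinear]), and the
    chain rule writes the tangent vector of the model at [x] as the softmax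
    Jacobian applied to the contraction of [d tau xi] with the features.
    Therefore the Fisher-Rao integrand of two tangent vectors is the bilinear
    form [C(f_x)] on two contractions, which is the Frobenius product of the
    tensor operator applied to [d tau zeta] with [d tau xi]
    ([fisher_rao_integrand]).

    For integrability, [C(z)] equals the softmax Jacobian
    [diag p - p p^T] ([fisher_pullbackE]); its entries are bounded by 1, and a
    product of two square integrable features is integrable. *)

(** * Differentiability in spaces of matrices *)

Section line_derivatives.
Context (R : realType).

(** A matrix valued map is the finite sum of its entries times the matrix
    units, so no estimate is needed. *)
Lemma differentiable_mx_comp (V : normedModType R) (a b : nat)
    (f : V -> 'M[R]_(a, b)) (x : V) :
  (forall i j, differentiable (fun y => f y i j : R^o) x) -> differentiable f x.
Proof.
move=> df.
have -> : f = \sum_i \sum_j (fun y => f y i j *: delta_mx i j).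
  apply/funext => y; rewrite fct_sumE [LHS]matrix_sum_delta.
  by apply: eq_bigr => i _; rewrite fct_sumE.
by apply: differentiable_sum => i; apply: differentiable_sum => j;
  exact: differentiableZl.
Qed.

(** The spaces of matrices are finite dimensional, where linearity implies
    continuity; this discharges the side condition of the differentiation rules
    for linear maps. *)
Lemma linear_mx_continuous (a b : nat) (W : normedModType R)
  (f : {linear 'M[R]_(a, b) -> W}) : continuous f.
Proof.
have -> : (f : _ -> _) = \sum_i \sum_j (fun y : 'M[R]_(a,b) => y i j *: f (delta_mx i j)).
  apply/funext => y; rewrite fct_sumE [in LHS](matrix_sum_delta y) linear_sum.
  apply: eq_bigr => i _; rewrite fct_sumE linear_sum.
  by apply: eq_bigr => j _; rewrite linearZ.
move=> x; apply/differentiable_continuous.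
by apply: differentiable_sum => i; apply: differentiable_sum => j;
  apply/differentiableZl/differentiable_coord.
Qed.

(** The difference quotient of [f] along a line is literally a difference
    quotient of [f], in the direction [v *: w]; hence derivatives along lines
    need no chain rule. *)
Lemma growth_line (V W : normedModType R) (f : V -> W) (y w : V) (t v h : R^o) :
  h^-1 *: (((fun s : R^o => f (y + s *: w)) \o shift t) (h *: v) - f (y + t *: w)) =
  h^-1 *: ((f \o shift (y + t *: w)) (h *: (v *: w)) - f (y + t *: w)).
Proof.
by rewrite /= scalerDl scalerA addrCA [y + t *: w]addrC.
Qed.

Lemma derivable_line (V W : normedModType R) (f : V -> W) (y w : V) (t v : R^o) :
  derivable (fun s : R^o => f (y + s *: w)) t v <-> derivable f (y + t *: w) (v *: w).
Proof.
by rewrite /derivable; under [in X in X <-> _]eq_fun do rewrite growth_line.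
Qed.

Lemma derive_line (V W : normedModType R) (f : V -> W) (y w : V) (t v : R^o) :
  'D_v (fun s : R^o => f (y + s *: w)) t = 'D_(v *: w) f (y + t *: w).
Proof.
by rewrite /derive; under eq_fun do rewrite growth_line.
Qed.

(** Homogeneity of a directional derivative in its direction holds without
    differentiability of [f]: only the restriction of [f] to one line matters. *)
Lemma is_deriveZ_dir (V W : normedModType R) (f : V -> W) (x e : V) (t : R) :
  derivable f x e -> is_derive x (t *: e) f (t *: 'D_e f x).
Proof.
move=> df; pose l := fun s : R^o => f (x + s *: e).
have x0 : x + (0 : R^o) *: e = x by rewrite scale0r addr0.
have dl : differentiable l 0.
  apply/derivable1_diffP; apply: (derivable_line f x e 0 1).2.
  by rewrite x0 scale1r.
apply: DeriveDef.
  by rewrite -x0; apply/(derivable_line f x e 0 t)/diff_derivable.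
have lD (u : R^o) : 'D_u l 0 = 'D_(u *: e) f x.
  by rewrite [LHS](derive_line f x e 0 u) x0.
rewrite -lD -[in RHS](scale1r e) -lD !deriveE //.
by rewrite -linearZ /= [_ *: 1]mulr1.
Qed.

(** Mean value inequality for [f] minus a linear function along a segment.
    The segment is parametrized by [0, 1] so that [t] may have
    either sign. *)
Lemma line_increment_le (V : normedModType R) (f : V -> R^o) (y e : V) (t c K : R) :
  (forall s : R, 0 <= s <= 1 -> derivable f (y + (s * t) *: e) e /\
     `|'D_e f (y + (s * t) *: e) - c| <= K) ->
  `|f (y + t *: e) - f y - t * c| <= K * `|t|.
Proof.
move=> fd; pose l : R -> R := fun s : R^o => f (y + s *: (t *: e)).
have ld (s : R) : 0 <= s <= 1 -> is_derive s 1 l (t * 'D_e f (y + (s * t) *: e)).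
  move=> /fd[df _]; have [d1 d2] := is_deriveZ_dir t df.
  apply: DeriveDef.
    by apply/(derivable_line f y (t *: e) s 1); rewrite scale1r scalerA.
  by rewrite [LHS](derive_line f y (t *: e) s 1) scale1r scalerA.
have [||s s01] := @MVT_segment R l (fun s => t * 'D_e f (y + (s * t) *: e)) 0 1 ler01.
- by move=> s; rewrite in_itv /= => /andP[s0 s1]; apply: ld; rewrite !ltW.
- apply: derivable_within_continuous => s; rewrite in_itv /= => s01.
  by have [] := ld s s01.
rewrite /l scale0r addr0 scale1r subr0 mulr1 => ->.
move: s01; rewrite in_itv /= => /fd[_ le_K].
by rewrite -mulrBr normrM mulrC ler_wpM2r.
Qed.
End line_derivatives.

Section continuous_partials.
Context (R : realType).

Lemma mx_norm_le (a b : nat) (h : 'M[R]_(a, b)) (M : R) :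
  0 <= M -> (forall i j, `|h i j| <= M) -> `|h| <= M.
Proof.
by move=> M0 hM; rewrite /Num.norm /= mx_normrE; apply: bigmax_le.
Qed.

Lemma le_mx_norm (a b : nat) (h : 'M[R]_(a, b)) i j : `|h i j| <= `|h|.
Proof.
by rewrite [leRHS]/Num.norm /= mx_normrE; apply: (le_bigmax _ _ (i, j)).
Qed.

(** Continuity of the partial derivatives at [x] gives differentiability at [x].
    An increment [h] is added one coordinate at a time; each of the partial
    increments has max norm at most that of [h], so the mean value inequality
    applies to every step inside the ball where the partial derivatives are
    close to their values at [x]. *)
Lemma differentiable_C1_scalar (a b : nat) (f : 'M[R]_(a, b) -> R^o) (x : 'M[R]_(a, b)) :
  (forall i j, \forall y \near x, derivable f y (delta_mx i j)) ->
  (forall i j, {for x, continuous ('D_(delta_mx i j) f)}) ->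
  differentiable f x.
Proof.
move=> fd fc; pose I : finType := ('I_a * 'I_b)%type.
pose e (p : I) : 'M[R]_(a, b) := delta_mx p.1 p.2.
pose D (p : I) : R := 'D_(e p) f x.
pose L (h : 'M[R]_(a, b)) : R^o := \sum_(p : I) h p.1 p.2 * D p.
have Llin : linear L.
  move=> k u v; rewrite /L /GRing.scale /= mulr_sumr -big_split /=.
  by apply: eq_bigr => p _; rewrite !mxE mulrDl mulrA.
pose LM := GRing.isLinear.Build _ _ _ _ _ Llin.
pose LL : {linear _ -> _} := HB.pack L LM.
have LC : continuous LL by exact: linear_mx_continuous.
suff fL : f \o shift x = cst (f x) + LL +o_ (0 : 'M[R]_(a, b)) id.
  by apply/diff_locallyP; rewrite (diff_unique LC fL).
apply/eqaddoP => eps eps0.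
(* One mean value estimate per coordinate; the successor keeps the divisor
   nonzero when the matrices are empty. *)
pose eps' := eps / (#|{: I}|.+1)%:R.
have eps'0 : 0 < eps' by rewrite divr_gt0.
have : \forall y \near x, forall p : I,
    derivable f y (e p) /\ `|'D_(e p) f y - D p| <= eps'.
  apply: (filter_forall (F := nbhs x)) => p; apply: filterI; first exact: fd.
  have /cvgrPdist_le/(_ _ eps'0) := fc p.1 p.2.
  by apply: filterS => y; rewrite distrC.
move=> /nbhs_ballP[d /= d0 ball_d].
rewrite nearE /=; apply/nbhs_ballP; exists d => //= h.
rewrite -ball_normE /= sub0r normrN => hd.
pose part (s : seq I) := \sum_(p <- s) h p.1 p.2 *: e p.
have partE s i j : uniq s -> part s i j = if (i, j) \in s then h i j else 0.
  elim: s => [|p s IHs] /=; first by rewrite /part big_nil mxE.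
  move=> /andP[ps us]; rewrite /part big_cons mxE [X in _ + X]IHs // !mxE.
  rewrite in_cons; case: (eqVneq (i, j) p) => [E|].
    by subst p; rewrite (negbTE ps) /= !eqxx mulr1 addr0.
  case: p {ps} => i' j' /=; rewrite xpair_eqE => /negbTE ->.
  by rewrite mulr0 add0r.
have step s : uniq s ->
    `|f (x + part s) - f x - \sum_(p <- s) h p.1 p.2 * D p|
      <= (size s)%:R * eps' * `|h|.
  elim: s => [_|p s IHs /= /andP[ps us]].
    by rewrite /part !big_nil addr0 !subrr normr0 !mul0r.
  rewrite /part !big_cons addrCA addrC.
  have := @line_increment_le R _ f (x + part s) (e p) (h p.1 p.2) (D p) eps'.
  have /[swap]/[apply] : forall r : R, 0 <= r <= 1 ->
      derivable f (x + part s + (r * h p.1 p.2) *: e p) (e p) /\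
      `|'D_(e p) f (x + part s + (r * h p.1 p.2) *: e p) - D p| <= eps'.
    move=> r /andP[r0 r1]; apply: ball_d.
    rewrite -ball_normE /= -addrA opprD addrA subrr sub0r normrN.
    apply: le_lt_trans hd; apply: mx_norm_le => // i j.
    rewrite mxE partE // !mxE.
    have [E|] := eqVneq (i, j) p.
      subst p; rewrite (negbTE ps) add0r !eqxx mulr1 normrM ger0_norm //.
      rewrite (le_trans _ (le_mx_norm h i j)) // ler_piMl //.
    case: p {ps} => i' j' /=; rewrite xpair_eqE => /negbTE ->.
    rewrite mulr0 addr0; case: ifP => _; first exact: le_mx_norm.
    by rewrite normr0.
  move=> le1; have le2 := IHs us.
  rewrite -/(part s) -natr1 mulrDl mul1r mulrDl.
  set A := f (x + part s + _) in le1 *; set B := f (x + part s) in le1 le2.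
  set S := \sum_(_ <- s) _ in le2 *.
  rewrite (_ : A - f x - _ = (B - f x - S) + (A - B - h p.1 p.2 * D p)); last first.
    by rewrite opprD; ring.
  rewrite (le_trans (ler_normD _ _)) // lerD //.
  by rewrite (le_trans le1) // ler_pM2l // le_mx_norm.
have := step (index_enum I) (index_enum_uniq _).
have -> : part (index_enum I) = h.
  apply/matrixP => i j; rewrite partE ?index_enum_uniq //.
  by rewrite mem_index_enum.
move=> {}step.
have -> : (f \o shift x - (cst (f x) + LL)) h =
    f (x + h) - f x - \sum_(p : I) h p.1 p.2 * D p.
  by rewrite [LHS](_ : _ = f (h + x) - (f x + L h)) // opprD addrA [h + x]addrC.
apply: le_trans step _.
rewrite ler_wpM2r // /eps' mulrCA ger_pMr // ler_pdivrMr // mul1r ler_nat.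
by rewrite /index_enum -enumT -cardE.
Qed.
End continuous_partials.

(** * Maps of class C^k *)

Section Ck_maps.
Context (R : realType).

(** A continuous linear map commutes with the limit of difference quotients;
    the inner map need only have a derivative in the direction [v]. *)
Lemma is_derive_linear_comp (V W W' : normedModType R) (L : {linear W -> W'})
    (f : V -> W) (x v : V) :
  continuous L -> derivable f x v -> is_derive x v (L \o f) (L ('D_v f x)).
Proof.
move=> Lc df.
have LD : (fun h => h^-1 *: (((L \o f) \o shift x) (h *: v) - (L \o f) x)) @ 0^'
    --> L ('D_v f x).
  rewrite (_ : (fun _ => _) = L \o (fun h => h^-1 *: ((f \o shift x) (h *: v) - f x))).
    by apply: cvg_comp; [exact: df|exact: Lc].
  by apply/funext => h; rewrite /comp [RHS]linearZ [in RHS]linearB.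
by apply: DeriveDef; [apply/cvg_ex; exists (L ('D_v f x))|exact/cvg_lim].
Qed.

(** Derivatives along [A] only see germs.  The closure properties below need
    this because the rules for derivatives hold at points of [A] only, whereas
    [Ck] speaks of derivatives as functions on the whole space. *)
Lemma Ck_ext (V W : normedModType R) k (A : set V) (f g : V -> W) :
  open A -> (forall x, A x -> f x = g x) -> Ck k A f -> Ck k A g.
Proof.
move=> oA; elim: k f g => [|k IHk] f g fg [fc fd].
  split=> // x Ax; suff : g @ x --> g x by []; rewrite -fg //.
  apply: cvg_trans (fc x Ax); apply: near_eq_cvg.
  by near=> y; apply: fg; near: y; exact: open_nbhs_nbhs.
have fgn x : A x -> {near x, f =1 g}.
  by move=> Ax; near=> y; apply: fg; near: y; exact: open_nbhs_nbhs.
split=> [x Ax|v].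
  suff : g @ x --> g x by []; rewrite -fg //.
  by apply: cvg_trans (fc x Ax); apply: near_eq_cvg; exact: fgn.
have [fdv fk] := fd v; split=> [x Ax|].
  by apply: near_eq_derivable (fgn x Ax) (fdv x Ax).
apply: IHk fk => x Ax; apply: near_eq_derive; exact: fgn.
Unshelve. all: by end_near. Qed.

Lemma Ck_linear_comp (V W W' : normedModType R) (L : {linear W -> W'}) k (A : set V)
    (f : V -> W) :
  open A -> continuous L -> Ck k A f -> Ck k A (L \o f).
Proof.
move=> oA Lc; elim: k f => [|k IHk] f [fc fd].
  split=> // x Ax; apply: continuous_comp; [exact: fc|exact: Lc].
split=> [x Ax|v].
  by apply: continuous_comp; [exact: fc|exact: Lc].
have [fdv fk] := fd v.
have LD x : A x -> is_derive x v (L \o f) (L ('D_v f x)).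
  by move=> Ax; apply: is_derive_linear_comp (fdv x Ax).
split=> [x /LD[]//|].
by apply: Ck_ext (IHk _ fk) => // x /LD[_ /= ->].
Qed.

Lemma Ck_cst (V W : normedModType R) k (A : set V) (c : W) : Ck k A (cst c).
Proof.
elim: k c => [|k IHk] c; split=> //; try by move=> x _; exact: cst_continuous.
move=> v; split=> [x _|]; first exact: derivable_cst.
by rewrite (_ : (fun x => _) = cst 0) //; apply/funext => x; exact: derive_cst.
Qed.

Lemma CkD (V W : normedModType R) k (A : set V) (f g : V -> W) :
  open A -> Ck k A f -> Ck k A g -> Ck k A (f + g).
Proof.
move=> oA; elim: k f g => [|k IHk] f g [fc fd] [gc gd].
  by split=> // x Ax; apply: continuousD; [exact: fc|exact: gc].
split=> [x Ax|v]; first by apply: continuousD; [exact: fc|exact: gc].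
have [fdv fk] := fd v; have [gdv gk] := gd v.
split=> [x Ax|]; first by apply: derivableD; [exact: fdv|exact: gdv].
apply: Ck_ext (IHk _ _ fk gk) => // x Ax /=.
by rewrite [LHS]/(_ + _) deriveD //; [exact: fdv|exact: gdv].
Qed.

Lemma Ck_sum (V W : normedModType R) k (A : set V) (I : finType) (f : I -> V -> W) :
  open A -> (forall i, Ck k A (f i)) -> Ck k A (\sum_i f i).
Proof.
move=> oA fk; apply: (big_ind (Ck k A)) => //; first exact: Ck_cst.
by move=> g h; exact: CkD.
Qed.

Lemma Ck_sub (V W : normedModType R) k (A B : set V) (f : V -> W) :
  B `<=` A -> Ck k A f -> Ck k B f.
Proof.
move=> BA; elim: k f => [|k IHk] f [fc fd]; split=> //; try by move=> x /BA /fc.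
move=> v; have [fdv fk] := fd v.
by split; [move=> x /BA /fdv|exact: IHk].
Qed.

(** The derivative of the restriction to a line is again a restriction of a
    directional derivative to the same line, so the induction closes. *)
Lemma Ck_line (V W : normedModType R) k (A : set V) (I : set R^o) (f : V -> W) (y w : V) :
  (forall t, I t -> A (y + t *: w)) -> Ck k A f ->
  Ck k I (fun t : R^o => f (y + t *: w)).
Proof.
move=> IA; elim: k f => [|k IHk] f [fc fd].
  split=> // t It; apply: (@continuous_comp _ _ _ (fun t : R^o => y + t *: w) f).
    by apply: continuousD; [exact: cst_continuous|exact: scalel_continuous].
  exact: (fc _ (IA _ It)).
split=> [t It|v].
  apply: (@continuous_comp _ _ _ (fun t : R^o => y + t *: w) f).
    by apply: continuousD; [exact: cst_continuous|exact: scalel_continuous].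
  exact: (fc _ (IA _ It)).
have [fdv fk] := fd (v *: w); split=> [t It|].
  by apply: (derivable_line f y w t v).2; apply: fdv; exact: IA.
have -> : 'D_v (fun t : R^o => f (y + t *: w)) =
    (fun t : R^o => 'D_(v *: w) f (y + t *: w)).
  by apply/funext => t; exact: derive_line.
exact: IHk fk.
Qed.

(** Bridge from the definition of smoothness by directional derivatives to
    Frechet differentiability, without which the chain rule fails. *)
Lemma differentiable_smooth_on (a b p q : nat) (A : set 'M[R]_(a, b))
    (f : 'M[R]_(a, b) -> 'M[R]_(p, q)) (x : 'M[R]_(a, b)) :
  open A -> smooth_on A f -> A x -> differentiable f x.
Proof.
move=> oA fs Ax; apply: differentiable_mx_comp => i j.
have clin : linear (fun M : 'M[R]_(p, q) => M i j : R^o).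
  by move=> k u v; rewrite !mxE.
pose cM := GRing.isLinear.Build _ _ _ _ _ clin.
pose c : {linear 'M[R]_(p, q) -> R^o} :=
  HB.pack (fun M : 'M[R]_(p, q) => M i j : R^o) cM.
have [_ fd] := Ck_linear_comp oA (@linear_mx_continuous _ _ _ _ c) (fs 1%N).
apply: differentiable_C1_scalar => k l; have [fdv [fc _]] := fd (delta_mx k l).
  by apply: filterS (open_nbhs_nbhs (conj oA Ax)); exact: fdv.
exact: fc.
Qed.
End Ck_maps.

(** * Tangent spaces of embedded submanifolds and of their products *)

Section submanifold.
Context (R : realType).

Lemma derive_diff_curve (V W : normedModType R) (f : V -> W) (c : R^o -> V) (t : R^o) :
  derivable c t 1 -> differentiable f (c t) ->
  is_derive t 1 (f \o c) ('d f (c t) ('D_1 c t)).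
Proof.
move=> /derivable1_diffP dc df.
have dfc : differentiable (f \o c) t by exact: differentiable_comp.
apply: DeriveDef; first exact: diff_derivable.
by rewrite !deriveE // diff_comp.
Qed.

(** A curve [c] in [A] becomes the curve [flat \o c] in [E], whose velocity is
    in [E] because [E] is the kernel of a linear map.  Conversely, if
    [w = 'd flat p v] is in [E] then the line [flat p + t *: w] stays in [E],
    and its image under [psi] is a curve in [A] whose velocity is
    ['d psi ('d flat p v) = v]. *)
Lemma tangent_submanifold (a b : nat) (A : set 'M[R]_(a, b)) (p : 'M[R]_(a, b))
    (O O' : set 'M[R]_(a, b)) (flat psi : 'M[R]_(a, b) -> 'M[R]_(a, b))
    (E : {vspace 'M[R]_(a, b)}) :
  A p -> open O -> O p -> open O' -> smooth_on O flat -> smooth_on O' psi ->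
  (forall x, O x -> O' (flat x) /\ psi (flat x) = x) ->
  (forall y, O' y -> O (psi y) /\ flat (psi y) = y) ->
  (forall x, O x -> (A x <-> flat x \in E)) ->
  forall v, tangent A p v <-> 'd flat p v \in E.
Proof.
move=> Ap oO Op oO2 sflat spsi flatK psiK AE v.
have dflat : differentiable flat p by exact: differentiable_smooth_on Op.
have [p2 psip] := flatK p Op.
have dpsi : differentiable psi (flat p) by exact: differentiable_smooth_on p2.
split=> [[e [c [e0 cs cA c0 cv]]]|Ev].
  (* [N] is the linear map with kernel [E]. *)
  pose N : {linear 'M[R]_(a, b) -> 'M[R]_(a, b)} := (\1 - projv E)%VF.
  have NE x : (N x == 0) = (x \in E).
    have -> : N x = x - projv E x.
      by rewrite -[LHS]/((\1 - projv E)%VF x) add_lfunE opp_lfunE id_lfunE.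
    rewrite subr_eq0; apply/eqP/idP => [->|/projv_id //]; exact: memv_proj.
  have I0 : (`]- e, e[%classic : set R) 0 by rewrite /= in_itv /= oppr_lt0 e0.
  have [cc /(_ 1)[/(_ 0 I0) dc _]] := cs 1%N.
  have cc0 := cc _ I0.
  have Ic : \forall t \near (0 : R^o), (N \o (flat \o c)) t = cst 0 t.
    have nI : \forall t \near (0 : R^o), (`]- e, e[%classic : set R) t.
      by apply: open_nbhs_nbhs; split=> //; exact: interval_open.
    have nO : \forall t \near (0 : R^o), O (c t).
      by apply: cc0; rewrite c0; exact: open_nbhs_nbhs.
    near=> t; rewrite /=; apply/eqP; rewrite NE; apply/AE; first by near: t.
    have : (`]- e, e[%classic : set R) t by near: t.
    by rewrite /= in_itv /=; exact: cA.
  have dfc : differentiable flat (c 0) by rewrite c0.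
  have [d1 d2] := derive_diff_curve dc dfc.
  have [_] := is_derive_linear_comp (@linear_mx_continuous _ _ _ _ N) d1.
  rewrite (near_eq_derive _ Ic) derive_cst d2 -derive1E cv c0 => /esym.
  by move=> /eqP; rewrite NE.
pose w := 'd flat p v; pose c := fun t : R^o => psi (flat p + t *: w).
have lc : continuous (fun t : R^o => flat p + t *: w).
  by move=> t; apply: cvgD; [exact: cvg_cst|exact: scalel_continuous].
have : \forall t \near (0 : R^o), O' (flat p + t *: w).
  by apply: lc; rewrite scale0r addr0; exact: open_nbhs_nbhs.
move=> /nbhs_ballP[e /= e0 eO'].
have IO' t : (`]- e, e[%classic : set R) t -> O' (flat p + t *: w).
  rewrite /= in_itv /= => te; apply: eO'.
  by rewrite -ball_normE /= sub0r normrN ltr_norml.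
exists e, c; split => //.
- by move=> k; apply: Ck_line IO' (spsi k).
- move=> t te; have [pc fc] := psiK _ (IO' t te).
  by apply/(AE _ pc); rewrite fc memvD ?memvZ //; apply/AE.
- by rewrite /c scale0r addr0.
rewrite derive1E [LHS](derive_line psi (flat p) w 0 1) scale1r scale0r addr0.
rewrite deriveE // -[LHS]/(('d psi (flat p) \o 'd flat p) v) -diff_comp //.
rewrite -deriveE; last exact: differentiable_comp.
rewrite (@near_eq_derive _ _ _ _ id).
  by rewrite derive_id.
by near=> x; apply: (flatK x _).2; near: x; exact: open_nbhs_nbhs.
Unshelve. all: by end_near. Qed.
End submanifold.

Section product_manifold.
Context (R : realType) (d' : nat) (m : 'I_d' -> nat).
Notation N := (\sum_(k < d') m k)%N.

Definition embed_block (k : 'I_d') (u : 'rV[R]_(m k)) : 'rV[R]_N :=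
  set_block 0 u.

Lemma submxrow_set_block (x : 'rV[R]_N) k (u : 'rV[R]_(m k)) l :
  submxrow (set_block x u) l = dfwith (fun l => submxrow x l) k u l.
Proof. exact: mxrowK. Qed.

Lemma submxrow_is_linear k : linear (fun x : 'rV[R]_N => submxrow x k).
Proof. by move=> s u v; apply/rowP => i; rewrite !mxE. Qed.

Lemma embed_block_is_linear k : linear (embed_block (k := k)).
Proof.
move=> s u v; apply/mxrowP => l.
rewrite [RHS](submxrow_is_linear l) !submxrow_set_block.
have [<-|kl] := eqVneq k l; first by rewrite !dfwithin.
by rewrite !dfwithout // submxrow0 scaler0 addr0.
Qed.

HB.instance Definition _ (k : 'I_d') :=
  GRing.isLinear.Build _ _ _ _ _ (@embed_block_is_linear k).

(** [submxrow] with the index first, so that each projection is a linear map. *)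
Definition block k (x : 'rV[R]_N) : 'rV[R]_(m k) := submxrow x k.
HB.instance Definition _ (k : 'I_d') :=
  GRing.isLinear.Build _ _ _ _ (@block k) (submxrow_is_linear k).

Lemma sum_embed_block (u : forall k, 'rV[R]_(m k)) :
  \sum_k embed_block (u k) = \mxrow_k u k.
Proof.
apply/mxrowP => l; rewrite submxrow_sum mxrowK (bigD1 l) //= big1 => [|k kl].
  by rewrite submxrow_set_block dfwithin addr0.
by rewrite submxrow_set_block dfwithout // submxrow0.
Qed.

(** Curves in a product are families of curves.  Forward, each projection is
    linear; backward, a curve is the sum of the embedded factor curves on the
    smallest of their intervals of definition. *)
Lemma tangent_product (U : forall k, set 'rV[R]_(m k)) (x v : 'rV[R]_N) :
  tangent (product_set U) x v <->
  forall k, tangent (U k) (submxrow x k) (submxrow v k).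
Proof.
split=> [[e [c [e0 cs cU c0 cv]]] k|Uv].
  have I0 : (`]- e, e[%classic : set R) 0 by rewrite /= in_itv /= oppr_lt0 e0.
  have [_ /(_ 1)[/(_ 0 I0) dc _]] := cs 1%N.
  have bc := @linear_mx_continuous _ _ _ _ (@block k).
  exists e, (@block k \o c); split=> //.
  - by move=> j; apply: Ck_linear_comp => //; exact: interval_open.
  - by move=> t te; exact: cU.
  - by rewrite /= c0.
  by have [_ dD] := is_derive_linear_comp bc dc; rewrite derive1E dD -derive1E cv.
have {}Uv k : {ec : R * (R^o -> 'rV[R]_(m k)) |
    [/\ 0 < ec.1, smooth_on (`]- ec.1, ec.1[%classic : set R^o) ec.2,
      (forall t, - ec.1 < t < ec.1 -> U k (ec.2 t)),
      ec.2 0 = submxrow x k & derive1 ec.2 0 = submxrow v k]}.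
  by apply: cid; have [e [c ec]] := Uv k; exists (e, c).
pose E k := (sval (Uv k)).1; pose C k := (sval (Uv k)).2.
pose e := \big[Num.min/1]_k E k.
have eE k : e <= E k by exact: bigmin_le.
have e0 : 0 < e.
  by apply: lt_bigmin => // k _; have [] := svalP (Uv k).
have I0 : (`]- e, e[%classic : set R) 0 by rewrite /= in_itv /= oppr_lt0 e0.
have oI : open (`]- e, e[%classic : set R^o) by exact: interval_open.
have Cs k : smooth_on (`]- e, e[%classic : set R^o) (C k).
  have [_ + _ _ _] := svalP (Uv k) => Cs j; apply: Ck_sub (Cs j).
  move=> t /=; rewrite !in_itv /= => /andP[t1 t2].
  by rewrite (lt_le_trans t2 (eE k)) (le_lt_trans _ t1) // lerN2 eE.
have ec k := @linear_mx_continuous _ _ _ _ (@embed_block k).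
exists e, (\sum_k (@embed_block k \o C k)); split=> //.
- by move=> j; apply: Ck_sum => // k; exact: (Ck_linear_comp oI (ec k) (Cs k j)).
- move=> t te k; rewrite fct_sumE sum_embed_block [submxrow _ _]mxrowK.
  have [_ _ + _ _] := svalP (Uv k); apply.
  move/andP: te => [t1 t2].
  by rewrite (lt_le_trans t2 (eE k)) (le_lt_trans _ t1) // lerN2 eE.
- rewrite fct_sumE sum_embed_block -[RHS]submxrowK; apply: eq_mxrow => k.
  by have [] := svalP (Uv k).
have Cd k : is_derive (0 : R^o) 1 (@embed_block k \o C k) (embed_block (submxrow v k)).
  have [_ _ _ _ <-] := svalP (Uv k); rewrite derive1E.
  have [_ /(_ 1)[/(_ 0 I0) dc _]] := Cs k 1%N.
  exact: (is_derive_linear_comp (ec k) dc).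
rewrite derive1E derive_sum; last by move=> k; have [] := Cd k.
rewrite -[RHS]submxrowK -sum_embed_block; apply: eq_bigr => k _.
by have [] := Cd k.
Qed.

(** Each factor of the tangent space is the preimage of a linear subspace under
    the differential of a slice chart. *)
Lemma tangent_product_linear (U : forall k, set 'rV[R]_(m k)) (x : 'rV[R]_N) :
  (forall k, embedded_submanifold (U k)) -> product_set U x ->
  tangent (product_set U) x 0 /\
  forall (a : R) u v, tangent (product_set U) x u -> tangent (product_set U) x v ->
    tangent (product_set U) x (a *: u + v).
Proof.
move=> Usub Ux.
have Tk k : exists (L : {linear 'rV[R]_(m k) -> 'rV[R]_(m k)})
    (E : {vspace 'rV[R]_(m k)}),
    forall v, tangent (U k) (submxrow x k) v <-> L v \in E.
  have [r /(_ _ (Ux k))] := Usub k.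
  move=> [A [A' [flat [psi [E [[oA Ap oA'] [sf sp] fK pK [_ UE]]]]]]].
  exists ('d flat (submxrow x k)), E.
  exact: (tangent_submanifold (Ux k) oA Ap oA' sf sp fK pK UE).
split=> [|a u v /tangent_product Tu /tangent_product Tv]; apply/tangent_product => k;
  have [L [E LE]] := Tk k; apply/LE.
  by rewrite submxrow0 linear0 mem0v.
have /LE Lu := Tu k; have /LE Lv := Tv k.
by rewrite (submxrow_is_linear k) linearP memvD // memvZ.
Qed.
End product_manifold.

(** * Adjoints on inner product subspaces of R^N *)

Section riesz.
Context (R : realType) (N : nat) (T : set 'rV[R]_N).
Context (T0 : T 0) (TL : forall a u v, T u -> T v -> T (a *: u + v)).

Lemma subspace_sum (I : finType) (c : I -> R) (b : I -> 'rV[R]_N) :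
  (forall i, T (b i)) -> T (\sum_i c i *: b i).
Proof. by move=> bT; elim/big_rec: _ => // i x _; exact: TL. Qed.

(** Linearity of the metric is only available on [T], hence this version of
    the expansion of a linear form, which keeps track of membership. *)
Lemma linear_form_sum (f : 'rV[R]_N -> R) (I : finType) (c : I -> R) (b : I -> 'rV[R]_N) :
  (forall a u v, T u -> T v -> f (a *: u + v) = a * f u + f v) ->
  (forall i, T (b i)) -> f (\sum_i c i *: b i) = \sum_i c i * f (b i).
Proof.
move=> fL bT.
have f0 : f 0 = 0.
  by have := fL (-1) 0 0 T0 T0; rewrite scaler0 add0r mulN1r addNr.
suff [] : T (\sum_i c i *: b i) /\ f (\sum_i c i *: b i) = \sum_i c i * f (b i) by [].
apply: (big_ind2 (fun x y => T x /\ f x = y)) => [//|x1 x2 y1 y2 [Tx <-] [Ty <-]|i _].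
  have -> : x1 + y1 = 1 *: x1 + y1 by rewrite scale1r.
  by rewrite fL // mul1r; split=> //; exact: TL.
have -> : c i *: b i = c i *: b i + 0 by rewrite addr0.
by split; [exact: TL|rewrite fL // f0 addr0].
Qed.

Context (g : 'rV[R]_N -> 'rV[R]_N -> R)
  (gC : forall u v, T u -> T v -> g u v = g v u)
  (gL : forall a u v w, T u -> T v -> T w -> g (a *: u + v) w = a * g u w + g v w)
  (gpos : forall u, T u -> u != 0 -> 0 < g u u).

Definition orthonormal_family (r : nat) (b : 'I_r -> 'rV[R]_N) : Prop :=
  (forall q, T (b q)) /\ forall p q, g (b p) (b q) = (p == q)%:R.

Lemma orthonormal_coord r (b : 'I_r -> 'rV[R]_N) (c : 'I_r -> R) p :
  orthonormal_family b -> g (\sum_q c q *: b q) (b p) = c p.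
Proof.
move=> [bT bb]; rewrite (linear_form_sum (f := g^~ (b p))) //; last first.
  by move=> a u v Tu Tv; exact: gL.
rewrite (bigD1 p) //= bb eqxx mulr1 big1 ?addr0 // => q qp.
by rewrite bb (negbTE qp) mulr0.
Qed.

(** Orthonormal vectors are linearly independent. *)
Lemma orthonormal_family_size r (b : 'I_r -> 'rV[R]_N) :
  orthonormal_family b -> (r <= N)%N.
Proof.
move=> ob; pose B : 'M[R]_(r, N) := \matrix_q b q.
suff /eqP <- : row_free B by exact: rank_leq_col.
apply: inj_row_free => v; rewrite mulmx_sum_row.
under eq_bigr do rewrite rowK.
move=> vB; apply/rowP => p; rewrite -(orthonormal_coord (v 0) p ob) vB mxE.
have [bT _] := ob; have := gL (-1) T0 T0 (bT p).
by rewrite scaler0 add0r mulN1r addNr.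
Qed.

(** A maximal orthonormal family spans: the part of [v] orthogonal to the family
    could otherwise be normalized and added to it. *)
Lemma orthonormal_basis : exists (r : nat) (b : 'I_r -> 'rV[R]_N),
  orthonormal_family b /\ forall v, T v -> v = \sum_q g v (b q) *: b q.
Proof.
pose P r := `[< exists b : 'I_r -> 'rV[R]_N, orthonormal_family b >].
have P0 : exists r, P r.
  by exists 0%N; apply/asboolP; exists (fun=> 0); split; case.
have PN r : P r -> (r <= N)%N by move=> /asboolP[b]; exact: orthonormal_family_size.
have [r /asboolP[b ob] r_max] := ex_maxnP P0 PN.
exists r, b; split=> // v Tv; apply/eqP; rewrite -subr_eq0; apply/negPn/negP.
have [bT bb] := ob.
set s := \sum_q _; set w := v - s => w0.
have Ts : T s by exact: subspace_sum.
have Tw : T w by rewrite /w addrC -scaleN1r; exact: TL.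
have wb p : g w (b p) = 0.
  by rewrite /w addrC -scaleN1r gL // orthonormal_coord // mulN1r addNr.
have gw := gpos Tw w0.
pose k := (Num.sqrt (g w w))^-1.
have k2 : k * (k * g w w) = 1.
  rewrite mulrA -expr2 exprVn sqr_sqrtr ?ltW // mulVf // gt_eqF //.
have Tkw : T (k *: w) by rewrite -[_ *: _]addr0; exact: TL.
have gkw u : T u -> g (k *: w) u = k * g w u.
  move=> Tu; rewrite -[k *: w]addr0 gL //.
  by have := gL (-1) T0 T0 Tu; rewrite scaler0 add0r mulN1r addNr => ->; rewrite addr0.
(* [b] extended by the normalized remainder. *)
pose b' (i : 'I_r.+1) := if unlift ord_max i is Some q then b q else k *: w.
have : P r.+1.
  apply/asboolP; exists b'; split=> [q|p q]; rewrite /b'.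
    by case: unliftP => [j|] _.
  case: (unliftP ord_max p) => [i|] ->; case: (unliftP ord_max q) => [j|] ->.
  - by rewrite bb (inj_eq lift_inj).
  - by rewrite gC // gkw // wb mulr0 eq_sym (negbTE (neq_lift _ _)).
  - by rewrite gkw // wb mulr0 (negbTE (neq_lift _ _)).
  - by rewrite gkw // gC // gkw // k2 eqxx.
by move=> /r_max; rewrite ltnn.
Qed.

(** Both existence and uniqueness of the Riesz representative can be read off
    from coordinates in the orthonormal basis. *)
Lemma adjoint_orthonormal (W : Type) (h : W -> W -> R) (L : 'rV[R]_N -> W) (w : W)
    r (b : 'I_r -> 'rV[R]_N) :
  orthonormal_family b -> (forall v, T v -> v = \sum_q g v (b q) *: b q) ->
  (forall a u v, T u -> T v -> h w (L (a *: u + v)) = a * h w (L u) + h w (L v)) ->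
  adjoint T g h L w = \sum_q h w (L (b q)) *: b q.
Proof.
move=> [bT bb] bE hL; apply: xget_unique => [|v [Tv gv]].
  have TS := subspace_sum (fun q => h w (L (b q))) bT.
  split=> // xi Txi.
  rewrite (linear_form_sum (f := g^~ xi)) //; last by move=> *; exact: gL.
  rewrite [in RHS](bE xi Txi) (linear_form_sum (f := fun u => h w (L u))) //.
  by apply: eq_bigr => q _; rewrite mulrC gC.
by rewrite (bE v Tv); apply: eq_bigr => q _; rewrite gv.
Qed.
End riesz.

(** * Multilinear maps of block vectors *)

Section multilinear.
Context (R : realType) (d' : nat) (m : 'I_d' -> nat).
Notation N := (\sum_(k < d') m k)%N.

(** The blocks of a variable vector are freed one at a time along [s], which
    turns multilinearity into an induction on [s]. *)
Definition fill_blocks (s : seq 'I_d') (x y : 'rV[R]_N) : 'rV[R]_N :=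
  \mxrow_k (if k \in s then submxrow y k else submxrow x k).

Lemma set_block_fill s (x y : 'rV[R]_N) k (u : 'rV[R]_(m k)) :
  k \notin s -> set_block (fill_blocks s x y) u = fill_blocks s (set_block x u) y.
Proof.
move=> ks; apply/mxrowP => l; rewrite submxrow_set_block /fill_blocks mxrowK.
have [<-|kl] := eqVneq k l.
  by rewrite dfwithin (negbTE ks) submxrow_set_block dfwithin.
by rewrite dfwithout // mxrowK submxrow_set_block dfwithout.
Qed.

Lemma fill_blocks_cons s (x y : 'rV[R]_N) k :
  fill_blocks (k :: s) x y = set_block (fill_blocks s x y) (submxrow y k).
Proof.
apply/mxrowP => l; rewrite submxrow_set_block /fill_blocks mxrowK in_cons.
have [<-|kl] := eqVneq k l; first by rewrite dfwithin.
by rewrite dfwithout // mxrowK; case: eqP kl => // ->; rewrite eqxx.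
Qed.

Lemma multilinear_block_expand (W : lmodType R) (tau : 'rV[R]_N -> W) (x : 'rV[R]_N) k
    (u : 'rV[R]_(m k)) :
  multilinear tau ->
  tau (set_block x u) = \sum_j u 0 j *: tau (set_block x (delta_mx 0 j)).
Proof.
move=> tauL; have L : linear (fun v : 'rV[R]_(m k) => tau (set_block x v)).
  by move=> a v w; exact: tauL.
pose LM := GRing.isLinear.Build _ _ _ _ _ L.
pose LL : {linear _ -> _} := HB.pack (fun v : 'rV[R]_(m k) => tau (set_block x v)) LM.
rewrite -[LHS]/(LL u) [in LHS](row_sum_delta u) linear_sum.
by apply: eq_bigr => j _; rewrite linearZ.
Qed.

(** By induction on the set of free blocks, each entry of [tau] is a finite sum
    of products of a coordinate of the block freed last and of a function of
    the other free blocks. *)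
Lemma differentiable_multilinear (a b : nat) (tau : 'rV[R]_N -> 'M[R]_(a, b)) (x : 'rV[R]_N) :
  multilinear tau -> differentiable tau x.
Proof.
move=> tauL; apply: differentiable_mx_comp => p q.
suff fd s : uniq s -> forall z,
    differentiable (fun y => tau (fill_blocks s z y) p q : R^o) x.
  have := fd (enum 'I_d') (enum_uniq _) 0.
  rewrite (_ : (fun y => _) = (fun y => tau y p q)) //; apply/funext => y.
  congr (tau _ p q); apply/mxrowP => k.
  by rewrite /fill_blocks mxrowK mem_enum.
elim: s => [_ z|k s IHs /= /andP[ks us] z].
  rewrite (_ : (fun y => _) = cst (tau z p q)); first exact: differentiable_cst.
  apply/funext => y; congr (tau _ p q); apply/mxrowP => k.
  by rewrite /fill_blocks mxrowK.
have -> : (fun y => tau (fill_blocks (k :: s) z y) p q) =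
    \sum_j ((fun y : 'rV[R]_N => y 0 (tagnat.Rank k j)) *
      (fun y => tau (fill_blocks s (set_block z (delta_mx 0 j)) y) p q)).
  apply/funext => y; rewrite fill_blocks_cons multilinear_block_expand // summxE fct_sumE.
  by apply: eq_bigr => j _; rewrite 2!mxE set_block_fill.
apply: differentiable_sum => j; apply: differentiableM; last exact: IHs.
exact: differentiable_coord.
Qed.
End multilinear.

(** * The softmax map and the Fisher metric *)

Section softmax.
Context (R : realType) (n0 : nat).
Implicit Types z h : 'cV[R]_n0.

Lemma sum_expR_gt0 z (j : 'I_n0) : 0 < \sum_k expR (z k 0).
Proof.
by rewrite (bigD1 j) //= ltr_pwDl ?expR_gt0 // sumr_ge0 // => k _; exact: expR_ge0.
Qed.

Lemma softmax_gt0 z j : 0 < softmax z j 0.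
Proof. by rewrite mxE divr_gt0 ?expR_gt0 // sum_expR_gt0. Qed.

Lemma sum_softmax z (j : 'I_n0) : \sum_k softmax z k 0 = 1.
Proof.
under eq_bigr do rewrite mxE.
by rewrite -mulr_suml divff // gt_eqF // sum_expR_gt0.
Qed.

Lemma softmax_le1 z j : softmax z j 0 <= 1.
Proof.
rewrite -(sum_softmax z j) (bigD1 j) //= lerDl sumr_ge0 // => k _.
by rewrite ltW // softmax_gt0.
Qed.

(** With [p = softmax z] and [J = diag p - p p^T], one has
    [J^T diag(1/p) J = J], since [p] sums to 1: the softmax Jacobian is
    the Fisher matrix of the categorical distribution in its natural
    parameters. *)
Lemma fisher_pullbackE z : fisher_pullback z = softmax_jacobian z.
Proof.
apply/matrixP => a b; pose p k := softmax z k 0.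
have p0 k : p k != 0 by rewrite gt_eqF // softmax_gt0.
have JE i j : softmax_jacobian z i j = p i * ((i == j)%:R - p j) by rewrite [LHS]mxE.
transitivity (\sum_k p k * ((k == a)%:R - p a) * ((k == b)%:R - p b)).
  rewrite /fisher_pullback -mulmxA mul_diag_mx [LHS]mxE; apply: eq_bigr => k _.
  rewrite [X in X * _]mxE [X in _ * X]mxE [X in _ * (X * _)]mxE !JE -/(p k).
  by rewrite [(p k)^-1 * _]mulrA mulVf //; ring.
rewrite JE.
transitivity (\sum_k ((k == a)%:R * (p k * ((k == b)%:R - p b)) -
    p a * ((k == b)%:R * p k - p b * p k))).
  by apply: eq_bigr => k _; ring.
have delta (i : 'I_n0) (F : 'I_n0 -> R) : \sum_k (k == i)%:R * F k = F i.
  rewrite (bigD1 i) //= eqxx mul1r big1 ?addr0 // => k /negbTE ->.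
  by rewrite mul0r.
rewrite sumrB delta -mulr_sumr sumrB delta -mulr_sumr (sum_softmax z a).
by rewrite mulr1 subrr mulr0 subr0.
Qed.

(** The Fisher matrix is bounded uniformly in [z], which is what makes the
    integrals converge under a square integrability assumption on the features. *)
Lemma fisher_pullback_le1 z a b : `|fisher_pullback z a b| <= 1.
Proof.
rewrite fisher_pullbackE mxE normrM (ger0_norm (ltW (softmax_gt0 z a))).
have := softmax_gt0 z b; have := softmax_le1 z b => b1 b0.
rewrite mulr_ile1 ?softmax_le1 // ?(ltW (softmax_gt0 z a)) //.
by rewrite ler_norml; case: eqP => _ /=; lra.
Qed.

Lemma is_derive_expR_coord z h k :
  differentiable (fun y : 'cV[R]_n0 => expR (y k 0) : R^o) z /\
  is_derive z h (fun y : 'cV[R]_n0 => expR (y k 0) : R^o) (expR (z k 0) * h k 0).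
Proof.
pose c := (fun y : 'cV[R]_n0 => y k 0 : R^o).
have clin : linear c by move=> s u v; rewrite /c !mxE.
pose cM := GRing.isLinear.Build _ _ _ _ _ clin.
pose C : {linear 'cV[R]_n0 -> R^o} := HB.pack c cM.
have cC : continuous C by exact: linear_mx_continuous.
have dc : differentiable c z by exact: (linear_differentiable z cC).
have de : differentiable (expR : R^o -> R^o) (c z).
  by apply/derivable1_diffP; exact: derivable_expR.
have dec : differentiable (expR \o c) z by exact: differentiable_comp.
split; first exact: dec.
have ded : derivable (expR \o c) z h by exact: diff_derivable.
apply: (DeriveDef ded).
rewrite [LHS](deriveE h dec) diff_comp //= (diff_lin z cC) (diff1E de).
by rewrite derive1E derive_val mulrC.
Qed.

(** The quotient rule gives
    [p j * (h j - \sum_k p k * h k)], which is the [j]-th entry of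
    [softmax_jacobian z *m h]. *)
Lemma is_derive_softmax_coord z h (j : 'I_n0) :
  differentiable (fun y : 'cV[R]_n0 => softmax y j 0 : R^o) z /\
  is_derive z h (fun y : 'cV[R]_n0 => softmax y j 0 : R^o)
    ((softmax_jacobian z *m h) j 0).
Proof.
pose E k := fun y : 'cV[R]_n0 => expR (y k 0) : R^o.
pose S := \sum_k E k.
have Sy y : S y = \sum_k expR (y k 0) by rewrite /S fct_sumE.
have S0 : S z != 0 by rewrite Sy gt_eqF // sum_expR_gt0.
have -> : (fun y : 'cV[R]_n0 => softmax y j 0 : R^o) = E j * (fun y => (S y)^-1).
  by apply/funext => y; rewrite mxE /= [RHS]/(_ * _) Sy.
have dE k : differentiable (E k) z by have [] := is_derive_expR_coord z 0 k.
have DE k : 'D_h (E k) z = expR (z k 0) * h k 0.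
  by have [_ []] := is_derive_expR_coord z h k.
have dS : differentiable S z by exact: differentiable_sum.
have DS : 'D_h S z = \sum_k expR (z k 0) * h k 0.
  rewrite derive_sum; last by move=> k; exact: diff_derivable.
  by apply: eq_bigr.
have dVS : differentiable (fun y => (S y)^-1 : R^o) z by exact: differentiableV.
have dES : differentiable (E j * (fun y => (S y)^-1 : R^o)) z by exact: differentiableM.
split=> //; apply: DeriveDef; first exact: diff_derivable.
rewrite deriveM ?deriveV //; try exact: diff_derivable.
rewrite DE DS mxE.
pose p k := softmax z k 0.
have pE (k : 'I_n0) : p k = E k z * (S z)^-1 by rewrite /p mxE Sy.
transitivity (p j * (h j 0 - \sum_k p k * h k 0)).
  rewrite pE.
  have -> : \sum_k p k * h k 0 = (S z)^-1 * \sum_k expR (z k 0) * h k 0.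
    by rewrite mulr_sumr; apply: eq_bigr => k _; rewrite pE /E; ring.
  rewrite /GRing.scale /= -/(E j z); field; exact: S0.
have -> : h j 0 = \sum_k (j == k)%:R * h k 0.
  rewrite (bigD1 j) //= eqxx mul1r big1 ?addr0 // => k.
  by rewrite eq_sym => /negbTE ->; rewrite mul0r.
rewrite -sumrB mulr_sumr; apply: eq_bigr => k _.
by rewrite [softmax_jacobian _ _ _]mxE -/(p j) -/(p k) -mulrA -mulrBl.
Qed.

Lemma differentiable_softmax z : differentiable (@softmax R n0) z.
Proof.
apply: differentiable_mx_comp => j i; rewrite ord1.
by have [] := is_derive_softmax_coord z 0 j.
Qed.

Lemma diff_softmax z h : 'd (@softmax R n0) z h = softmax_jacobian z *m h.
Proof.
rewrite -deriveE; last exact: differentiable_softmax.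
rewrite derive_mx; last exact/diff_derivable/differentiable_softmax.
apply/matrixP => j i; rewrite ord1 mxE.
by have [_ [_ <-]] := is_derive_softmax_coord z h j.
Qed.
End softmax.

(** * The Fisher-Rao metric on the tensor model *)

Section contraction.
Context (R : realType) (d n0 : nat) (n : 'I_d -> nat) (Omega : 'I_d -> set R)
  (Omega0 : forall nu, Omega nu !=set0) (phi : forall nu, R -> 'cV[R]_(n nu)).
Implicit Types (A B : tensor R n0 n) (x : borel_domain Omega0).

Lemma contraction_is_linear x : linear (fun A => Defs.contraction phi A x).
Proof.
move=> s A B; apply/colP => k; rewrite !mxE mulr_sumr -big_split /=.
by apply: eq_bigr => j _; rewrite /tensor_entry !mxE mulrDl mulrA.
Qed.

Lemma prod_feature_gram (i j : multi_index n) x :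
  \prod_nu (phi nu (coordinate x nu) *m (phi nu (coordinate x nu))^T) (i nu) (j nu)
  = product_feature phi i x * product_feature phi j x.
Proof.
by rewrite -big_split /=; apply: eq_bigr => nu _; rewrite mxE big_ord1 mxE.
Qed.

(** The rank one structure of the feature Gram matrices lets the sum over pairs
    of multi-indices factor into two contractions. *)
Lemma frobenius_tensor_op (C : 'M[R]_n0) A B x :
  frobenius (tensor_op C
    (fun nu => phi nu (coordinate x nu) *m (phi nu (coordinate x nu))^T) A) B =
  ((Defs.contraction phi A x)^T *m C^T *m Defs.contraction phi B x) 0 0.
Proof.
rewrite -trmx_mul mxE /frobenius; apply: eq_bigr => k _.
rewrite [in RHS]mxE [X in X * _]mxE [X in _ * X]mxE mulr_sumr.
apply: eq_bigr => j _; rewrite mulrCA mulrC; congr (_ * _).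
rewrite {1}/tensor_entry mxE enum_rankK mulr_suml; apply: eq_bigr => l _.
rewrite [in RHS]mxE mulr_sumr mulr_suml; apply: eq_bigr => j' _.
rewrite prod_feature_gram.
ring.
Qed.

Context (d' : nat) (m : 'I_d' -> nat)
  (tau : 'rV[R]_(\sum_(k < d') m k) -> tensor R n0 n).

Lemma diff_fun_softmax_model Theta xi x :
  differentiable tau Theta ->
  diff_fun (softmax_model Omega0 phi tau) Theta xi x =
  softmax_jacobian (Defs.contraction phi (tau Theta) x) *m
    Defs.contraction phi ('d tau Theta xi) x.
Proof.
move=> dtau.
pose GM := GRing.isLinear.Build _ _ _ _ _ (contraction_is_linear x).
pose G : {linear _ -> _} := HB.pack (fun A => Defs.contraction phi A x) GM.
have cG : continuous G by exact: linear_mx_continuous.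
have dG A : differentiable G A by exact: linear_differentiable.
have dGt : differentiable (G \o tau) Theta by exact: differentiable_comp.
rewrite /diff_fun -diff_softmax.
rewrite -[LHS]/('d ((@softmax R n0) \o (G \o tau)) Theta xi).
rewrite diff_comp //; last exact: differentiable_softmax.
by rewrite /= diff_comp // /= (diff_lin _ cG).
Qed.

(** The two integrands agree pointwise: after the chain rule both softmax
    Jacobians meet the Fisher matrix and form [fisher_pullback]. *)
Lemma fisher_rao_integrand Theta zeta xi x :
  differentiable tau Theta ->
  ((diff_fun (softmax_model Omega0 phi tau) Theta zeta x)^T *m
     fisher (softmax_model Omega0 phi tau Theta x) *m
     diff_fun (softmax_model Omega0 phi tau) Theta xi x) 0 0 =
  frobenius (tensor_op (fisher_pullback (Defs.contraction phi (tau Theta) x))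
    (fun nu => phi nu (coordinate x nu) *m (phi nu (coordinate x nu))^T)
    ('d tau Theta zeta)) ('d tau Theta xi).
Proof.
move=> dtau; rewrite frobenius_tensor_op !diff_fun_softmax_model //.
rewrite /fisher_pullback !trmx_mul trmxK /fisher tr_diag_mx /softmax_model.
by rewrite !mulmxA.
Qed.

End contraction.

Section linear_combination.
Context (R : realType) dd (X : measurableType dd) (mu : {measure set X -> \bar R})
  (I : finType) (c : I -> R) (F : I -> X -> R).
Context (intF : forall i, mu.-integrable setT (EFin \o F i)).

Lemma Rintegral_lincomb :
  mu.-integrable setT (EFin \o (fun x => \sum_i c i * F i x)) /\
  \int[mu]_x (\sum_i c i * F i x) = \sum_i c i * \int[mu]_x F i x.
Proof.
elim: (index_enum I) => [|i s [ints IHs]].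
  split; under eq_fun do rewrite big_nil.
    exact: integrable0.
  by rewrite big_nil Rintegral_cst // mul0r.
have inti : mu.-integrable setT (EFin \o (fun x => c i * F i x)).
  exact: (integrableZl measurableT (c i) (intF i)).
split.
  under eq_fun do rewrite big_cons.
  exact: (integrableD measurableT inti ints).
under eq_Rintegral do rewrite big_cons.
by rewrite RintegralD // RintegralZl // IHs big_cons.
Qed.
End linear_combination.

Section gram.
Context (R : realType) (d n0 : nat) (n : 'I_d -> nat) (Omega : 'I_d -> set R)
  (Omega0 : forall nu, Omega nu !=set0) (mu : probability (borel_domain Omega0) R)
  (phi : forall nu, R -> 'cV[R]_(n nu)).
Context (phi_L2 : forall j : multi_index n,
     (product_feature phi j : borel_domain Omega0 -> R) \in Lfun mu 2%:E).
Implicit Types A B F : tensor R n0 n.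

Lemma measurable_product_feature (j : multi_index n) :
  measurable_fun setT (product_feature phi j : borel_domain Omega0 -> R).
Proof. by have /sub_Lfun_mfun := phi_L2 j; rewrite inE. Qed.

Lemma measurable_contraction F k :
  measurable_fun setT (fun x : borel_domain Omega0 => Defs.contraction phi F x k 0).
Proof.
under eq_fun do rewrite mxE.
apply: measurable_sum => j; apply: measurable_funM => //.
exact: measurable_product_feature.
Qed.

(** Writing the quotient of exponentials as the exponential of a difference
    reduces measurability to that of [expR] and [ln]. *)
Lemma measurable_softmax F k :
  measurable_fun setT
    (fun x : borel_domain Omega0 => softmax (Defs.contraction phi F x) k 0).
Proof.
have E z : softmax z k 0 = expR (z k 0 - ln (\sum_l expR (z l 0))).
  by rewrite mxE expRB lnK // posrE (sum_expR_gt0 z k).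
under eq_fun do rewrite E.
apply: measurableT_comp => //; apply: measurable_funB; first exact: measurable_contraction.
apply: measurableT_comp => //; apply: measurable_sum => l.
by apply: measurableT_comp => //; exact: measurable_contraction.
Qed.

Lemma integrable_fisher_feature F k l (i j : multi_index n) :
  mu.-integrable setT (EFin \o (fun x : borel_domain Omega0 =>
    fisher_pullback (Defs.contraction phi F x) k l *
      (product_feature phi i x * product_feature phi j x))).
Proof.
have Cm : measurable_fun setT (fun x : borel_domain Omega0 =>
    fisher_pullback (Defs.contraction phi F x) k l).
  under eq_fun do rewrite fisher_pullbackE mxE.
  apply: measurable_funM; first exact: measurable_softmax.
  by apply: measurable_funB => //; exact: measurable_softmax.
have Cb : [bounded fisher_pullback (Defs.contraction phi F x) k l
    | x in [set: borel_domain Omega0]].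
  exists 1; split; first exact: num_real.
  by move=> M M1 x _; apply: le_trans (fisher_pullback_le1 _ _ _) (ltW M1).
have pp := (Lfun1_integrable _ _).1 (Lfun2_mul_Lfun1 (phi_L2 i) (phi_L2 j)).
exact: (integrableMr measurableT Cm Cb pp).
Qed.

Lemma integrable_gram_form F A B :
  mu.-integrable setT (EFin \o (fun x : borel_domain Omega0 =>
    frobenius (tensor_op (fisher_pullback (Defs.contraction phi F x))
      (fun nu => phi nu (coordinate x nu) *m (phi nu (coordinate x nu))^T) A) B)).
Proof.
pose J := multi_index n.
(* A pair of tensor positions indexes one product of coefficients and one
   bounded function times a product of features. *)
pose c (p : 'I_n0 * J * ('I_n0 * J)) :=
  tensor_entry A p.2.1 p.2.2 * tensor_entry B p.1.1 p.1.2.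
pose f (p : 'I_n0 * J * ('I_n0 * J)) (x : borel_domain Omega0) :=
  fisher_pullback (Defs.contraction phi F x) p.1.1 p.2.1 *
    (product_feature phi p.1.2 x * product_feature phi p.2.2 x).
rewrite (_ : (fun x => _) = (fun x => \sum_p c p * f p x)).
  by apply: (Rintegral_lincomb _ _).1 => p; exact: integrable_fisher_feature.
apply/funext => x; rewrite /frobenius pair_big.
rewrite -(pair_bigA _ (fun p q => c (p, q) * f (p, q) x)) /=.
apply: eq_bigr => -[k j] _ /=.
rewrite -(pair_bigA _ (fun l i => c ((k, j), (l, i)) * f ((k, j), (l, i)) x)) /=.
rewrite {1}/tensor_entry mxE enum_rankK mulr_suml; apply: eq_bigr => l _.
rewrite mulr_suml; apply: eq_bigr => i _; rewrite /c /f /=.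
rewrite prod_feature_gram.
ring.
Qed.

End gram.

Lemma frobenius_linear_r (R : realType) (d n0 : nat) (n : 'I_d -> nat)
    (A : tensor R n0 n) (a : R) (B B' : tensor R n0 n) :
  frobenius A (a *: B + B') = a * frobenius A B + frobenius A B'.
Proof.
rewrite /frobenius mulr_sumr -big_split; apply: eq_bigr => k _ /=.
rewrite mulr_sumr -big_split; apply: eq_bigr => j _ /=.
by rewrite /tensor_entry !mxE; ring.
Qed.

(** * The Gram operator of the softmax model *)

Theorem proposition3p7 (R : realType) (d n0 : nat) (n : 'I_d -> nat)
  (Omega : 'I_d -> set R) (Omega0 : forall nu, Omega nu !=set0)
  (mu : probability (borel_domain Omega0) R)
  (phi : forall nu : 'I_d, R -> 'cV[R]_(n nu))
  (phi_continuous : forall nu, {within Omega nu, continuous (phi nu)})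
  (phi_independent : forall nu, linearly_independent_on (Omega nu) (phi nu))
  (phi_L2 : forall j : multi_index n,
     (product_feature phi j : borel_domain Omega0 -> R) \in Lfun mu 2%:E)
  (T : set (tensor R n0 n)) (T_submanifold : embedded_submanifold T)
  (d' : nat) (m : 'I_d' -> nat) (U : forall k : 'I_d', set 'rV[R]_(m k))
  (U_submanifold : forall k, embedded_submanifold (U k))
  (g : 'rV[R]_(\sum_(k < d') m k) -> 'rV[R]_(\sum_(k < d') m k) ->
       'rV[R]_(\sum_(k < d') m k) -> R)
  (g_metric : riemannian_metric (product_set U) g)
  (tau : 'rV[R]_(\sum_(k < d') m k) -> tensor R n0 n)
  (tau_multilinear : multilinear tau)
  (tau_smooth : smooth_map (product_set U) tau)
  (tau_onto : tau @` product_set U = T)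
  (S_manifold : submersively_parametrized (product_set U)
     (softmax_model Omega0 phi tau))
  (Theta : 'rV[R]_(\sum_(k < d') m k)) (MTheta : product_set U Theta) :
  let TM := tangent (product_set U) Theta in
  let Fbar := softmax_model Omega0 phi tau in
  operator_integrable mu TM (gram_integrand phi tau U g Theta) /\
  forall zeta, TM zeta ->
    softmax_model_adjoint phi tau mu U g Theta (diff_fun Fbar Theta zeta) =
    operator_integral mu (gram_integrand phi tau U g Theta) zeta.
Proof.
move=> TM Fbar.
have [T0 TL] := tangent_product_linear U_submanifold MTheta.
have [gC gL gpos _] := g_metric.
have dtau : differentiable tau Theta by exact: differentiable_multilinear.
have gC' := gC _ MTheta; have gpos' := gpos _ MTheta.
have gL' a u v w := gL _ MTheta a u v w.
(* One basis serves both adjoints, so that only coefficients are compared. *)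
have [r [b [ob bE]]] := orthonormal_basis T0 TL gC' gL' gpos'.
pose I zeta xi (x : borel_domain Omega0) := frobenius
  (tensor_op (fisher_pullback (Defs.contraction phi (tau Theta) x))
    (fun nu => phi nu (coordinate x nu) *m (phi nu (coordinate x nu))^T)
    ('d tau Theta zeta)) ('d tau Theta xi).
have intI zeta xi : mu.-integrable setT (EFin \o I zeta xi).
  exact: integrable_gram_form.
have gramE zeta x i : gram_integrand phi tau U g Theta x zeta 0 i =
    \sum_q b q 0 i * I zeta (b q) x.
  rewrite /gram_integrand /tau_adjoint.
  rewrite (adjoint_orthonormal T0 TL gC' gL' ob bE); last first.
    by move=> a u v _ _; rewrite linearP frobenius_linear_r.
  by rewrite summxE; apply: eq_bigr => q _; rewrite mxE mulrC.
have frE zeta xi : fisher_rao mu (Fbar Theta) (diff_fun Fbar Theta zeta)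
    (diff_fun Fbar Theta xi) = \int[mu]_x I zeta xi x.
  by apply: eq_Rintegral => x _; exact: fisher_rao_integrand.
split=> [zeta i Tzeta|zeta Tzeta].
  under eq_fun do rewrite gramE.
  exact: (Rintegral_lincomb _ (fun q => intI zeta (b q))).1.
rewrite /softmax_model_adjoint (adjoint_orthonormal T0 TL gC' gL' ob bE); last first.
  move=> a u v _ _; rewrite !frE -RintegralZl // -RintegralD //; last first.
    exact: (integrableZl measurableT a (intI zeta u)).
  by apply: eq_Rintegral => x _; rewrite /I linearP frobenius_linear_r.
apply/rowP => i; rewrite [RHS]mxE summxE.
under eq_Rintegral do rewrite gramE.
rewrite (Rintegral_lincomb _ (fun q => intI zeta (b q))).2.
by apply: eq_bigr => q _; rewrite mxE mulrC frE.
Qed.
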